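(* Let $(X,d)$ and $(Y,\rho)$ be finite nonempty ultrametric spaces with representing trees $T_X$ and $T_Y$, respectively, let $\eta\colon[0,\infty)\to[0,\infty)$ be a homeomorphism with $\eta(1)=1$, and let $f\colon X\to Y$ be a surjective $\eta$-quasisymmetric embedding. Then $T_X$ and $T_Y$ are isomorphic as rooted trees.
   Context: An ultrametric space is a metric space $(X,d)$ satisfying $d(x,y)\leqslant\max\{d(x,z),d(z,y)\}$ for all $x,y,z\in X$. An embedding between metric spaces is an injective continuous mapping that is a homeomorphism onto its image. Given a homeomorphism $\eta\colon[0,\infty)\to[0,\infty)$, an embedding $f\colon X\to Y$ between metric spaces $(X,d)$ and $(Y,\rho)$ is $\eta$-quasisymmetric if for all $a,b,x\in X$ and all $t>0$, $d(x,a)\leqslant t\,d(x,b)$ implies $\rho(f(x),f(a))\leqslant\eta(t)\,\rho(f(x),f(b))$. Representing tree. For a finite ultrametric space $(X,d)$ with $|X|\geqslant 2$, the diametrical graph $G_{D,X}$ has vertex set $X$, and $u,v\in X$ are adjacent if and only if $d(u,v)=\operatorname{diam} X$. It is known that $G_{D,X}$ is complete multipartite: there is $k\geqslant 2$ and a partition of $X$ into nonempty parts $X_1,\ldots,X_k$ such that two points are adjacent if and only if they lie in different parts. The representing tree $T_X$ of a finite nonempty ultrametric space $X$ is the labeled rooted tree, whose nodes are subsets of $X$, defined recursively as follows. The root is $X$, with label $\operatorname{diam} X$. If $|X|=1$, then $T_X$ consists of the single node $X$ with label $0$. If $|X|\geqslant 2$, the children of the root are the parts $X_1,\ldots,X_k$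 of $G_{D,X}$, with labels $\operatorname{diam} X_i$; the parts with $\operatorname{diam} X_i=0$ are leaves, and for each part with $\operatorname{diam} X_i>0$ the procedure is repeated with $X_i$ (with the restricted metric) in place of $X$. Two rooted trees $T_1$ with root $r_1$ and $T_2$ with root $r_2$ are isomorphic as rooted trees if there is a bijection $g\colon V(T_1)\to V(T_2)$ with $g(r_1)=r_2$ such that $\{u,v\}$ is an edge of $T_1$ if and only if $\{g(u),g(v)\}$ is an edge of $T_2$, for all $u,v\in V(T_1)$; labels are not required to be preserved. *)

(* Defs.v *)
From HB Require Import structures.
From mathcomp Require Import all_boot all_order all_algebra.
From mathcomp Require Import all_classical all_reals all_analysis.

Set Implicit Arguments.
Unset Strict Implicit.
Unset Printing Implicit Defensive.

Import Order.TTheory GRing.Theory Num.Theory.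
Import numFieldNormedType.Exports.

Local Open Scope classical_set_scope.
Local Open Scope ring_scope.

Definition ultrametric (R : realType) (X : metricType R) : Prop :=
  forall x y z : X, mdist x y <= Num.max (mdist x z) (mdist z y).

(* [f] and [g] matter only on [A] and [B], which carry the subspace topology. *)
Definition homeomorphism_on (S T : topologicalType) (A : set S) (B : set T)
    (f : S -> T) : Prop :=
  [/\ set_bij A B f,
      {within A, continuous f} &
      exists g : T -> S,
        {in A, cancel f g} /\ {within B, continuous g}].

Definition embedding (S T : topologicalType) (f : S -> T) : Prop :=
  [/\ injective f, continuous f & homeomorphism_on [set: S] (range f) f].

(* The half-line homeomorphism [eta] is represented by a function on all of   *)
(* [R]; its values at negative arguments are irrelevant.                      *)
Definition homeomorphism_half_line (R : realType) (eta : R -> R) : Prop :=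
  @homeomorphism_on R R `[0, +oo[ `[0, +oo[ eta.

Definition quasisymmetric_embedding (R : realType) (X Y : metricType R)
    (eta : R -> R) (f : X -> Y) : Prop :=
  embedding f /\
  forall (a b x : X) (t : R), 0 < t ->
    mdist x a <= t * mdist x b ->
    mdist (f x) (f a) <= eta t * mdist (f x) (f b).

(* Only the data of a rooted graph with labeled nodes: [label] and [edge] are *)
(* meaningful on elements of [nodes] only.                                    *)
Record labeled_rooted_graph (L N : Type) := LabeledRootedGraph {
  nodes : set N ;
  root_node : N ;
  edge  : N -> N -> Prop ;
  label : N -> L }.

Definition rooted_isomorphic (L M N : Type)
    (T1 : labeled_rooted_graph L M) (T2 : labeled_rooted_graph L N) : Prop :=
  exists g : M -> N,
    [/\ set_bij (nodes T1) (nodes T2) g,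
        g (root_node T1) = root_node T2 &
        forall u v : M, nodes T1 u -> nodes T1 v ->
          (edge T1 u v <-> edge T2 (g u) (g v))].

Section RepresentingTree.
Context {R : realType} {X : metricType R}.
Implicit Types (A B C : set X) (P : set (set X)).

(* [sup] is the true supremum here for nonempty bounded (e.g. finite) [A].    *)
Definition diam A : R :=
  sup [set r : R | exists x y : X, [/\ A x, A y & r = mdist x y]].

(* Adjacency in the diametrical graph of the subspace [A].                    *)
Definition diametrical A (u v : X) : Prop :=
  [/\ A u, A v & mdist u v = diam A].

(* [P] is the set of parts exhibiting the diametrical graph of [A] as a       *)
(* complete multipartite graph.                                               *)
Definition multipartition A P : Prop :=
  [/\ partition P id A,
      (exists B C, [/\ P B, P C & B <> C]) &
      forall u v : X, A u -> A v ->
        (diametrical A u v <->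
         exists B C, [/\ P B, P C, B <> C, B u & C v])].

(* [B] is a child of [A]; one-point sets have none.                           *)
Definition child A B : Prop :=
  (exists x y : X, [/\ A x, A y & x <> y]) /\
  (exists P, multipartition A P /\ P B).

Inductive tree_node : set X -> Prop :=
| tree_node_root : tree_node [set: X]
| tree_node_child A B : tree_node A -> child A B -> tree_node B.

End RepresentingTree.

Definition representing_tree (R : realType) (X : metricType R) :
    labeled_rooted_graph R (set X) :=
  {| nodes := [set A | tree_node A] ;
     root_node := [set: X] ;
     edge  := fun A B => child A B \/ child B A ;
     label := @diam R X |}.

(* Main.v *)
Require Import Defs.
From HB Require Import structures.
From mathcomp Require Import all_boot all_order all_algebra.
From mathcomp Require Import all_classical all_reals all_analysis.
Import Order.TTheory GRing.Theory Num.Theory.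
Import numFieldNormedType.Exports.
Local Open Scope classical_set_scope.
Local Open Scope ring_scope.

(** Since [eta] is strictly increasing and [eta 1 = 1], the quasisymmetry
inequality at [t = 1] and at [t < 1] shows that [f] preserves and reflects the
comparison of two distances to a common point. In an ultrametric space every
point of [A] is a center of [A], so [mdist u v = diam A] says that [v] is a
farthest point of [A] from [u]. The diametrical graphs, hence the children, of
[A] and [f @` A] therefore correspond under [f]. *)

Lemma homeomorphism_half_line_mono (R : realType) (eta : R -> R) :
  homeomorphism_half_line eta -> {in `[0, +oo[ &, {mono eta : x y / x <= y}}.
Proof.
move=> [[eta_fun eta_inj eta_surj] eta_cont _].
(* A continuous injection on an interval is strictly monotone; one pair of points in increasing
   order excludes the decreasing case. The pair is [0] and a preimage [s] of [eta 0 + 1]. *)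
apply: itv_continuous_inj_le eta_cont _ => //; last first.
  by move=> x y xI yI; apply: eta_inj; rewrite inE.
have eta0_ge0 : 0 <= eta 0.
  have := eta_fun 0; rewrite /= !in_itv /= !andbT; exact.
have [|s s_ge0 eta_s] := eta_surj (eta 0 + 1).
  by rewrite /= in_itv /= andbT addr_ge0.
exists 0, s; split => //.
- by rewrite in_itv /= lexx.
- move: s_ge0; rewrite /= in_itv /= andbT le0r => /orP[/eqP s0|//].
  by move: eta_s; rewrite s0 => /eqP; rewrite -subr_eq0 opprD addNKr oppr_eq0 oner_eq0.
- by rewrite eta_s lerDl.
Qed.

Lemma quasisymmetric_le (R : realType) (X Y : metricType R) (eta : R -> R)
    (f : X -> Y) (x a b : X) :
  homeomorphism_half_line eta -> eta 1 = 1 -> quasisymmetric_embedding eta f ->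
  (mdist (f x) (f a) <= mdist (f x) (f b)) = (mdist x a <= mdist x b).
Proof.
move=> eta_homeo eta1 [[f_inj _ _] f_qs]; apply/idP/idP; last first.
  by move=> xab; have := f_qs a b x 1 ltr01; rewrite eta1 !mul1r; apply.
apply: contraTT; rewrite -!ltNge => xba.
have xa : 0 < mdist x a := le_lt_trans (mdist_ge0 x b) xba.
have fxa : 0 < mdist (f x) (f a).
  by move: xa; rewrite !mdist_gt0; apply: contra_neq => /f_inj.
(* The ratio [t] below turns the premise of quasisymmetry into an equality, with
   [eta t < eta 1 = 1]. It has to be positive, so [b = x] is treated apart. *)
have [<-|xb] := eqVneq x b; first by rewrite mdistxx.
pose t := mdist x b / mdist x a.
have t0 : 0 < t by rewrite divr_gt0 // mdist_gt0.
have t1 : t < 1 by rewrite ltr_pdivrMr // mul1r.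
have eta_t1 : eta t < 1.
  rewrite -eta1 (leW_mono_in (homeomorphism_half_line_mono _ _ eta_homeo)) //.
    by rewrite in_itv /= (ltW t0).
  by rewrite in_itv /= ler01.
have := f_qs b a x t t0; rewrite divfK ?gt_eqF // => /(_ (lexx _)).
by move/le_lt_trans; apply; rewrite gtr_pMl.
Qed.

(** The strong triangle inequality through [u] bounds every distance in [A] by the larger of two
    distances from [u], so [diam A] is the greatest distance from [u]. *)
Lemma diametricalP (R : realType) (X : metricType R) (A : set X) (u v : X) :
  ultrametric X -> finite_set [set: X] ->
  diametrical A u v <->
  [/\ A u, A v & forall y, A y -> mdist u y <= mdist u v].
Proof.
move=> ultX finX; split=> [[Au Av uv]|[Au Av far]]; split => //.
  move=> y Ay; rewrite uv; apply: ub_le_sup; last by exists u, y.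
  (* The largest distance from [u] to any point of the finite space bounds the distances within [A],
     so the supremum [diam A] is a genuine one. *)
  have /finite_seqP[s sX] := finX.
  have in_s z : z \in s by have : [set: X] z by []; rewrite sX.
  exists (\big[Num.max/0]_(z <- s) mdist u z) => _ [x [z [_ _ ->]]].
  have le_max w : mdist u w <= \big[Num.max/0]_(z <- s) mdist u z.
    by apply: le_bigmax_seq.
  by rewrite (le_trans (ultX x z u)) // ge_max metric_sym !le_max.
apply/le_anti/andP; split.
  apply: ub_le_sup; last by exists u, v.
  exists (mdist u v) => _ [x [z [Ax Az ->]]].
  by rewrite (le_trans (ultX x z u)) // ge_max metric_sym !far.
apply: ge_sup => [|_ [x [z [Ax Az ->]]]]; first by exists (mdist u v), u, v.
by rewrite (le_trans (ultX x z u)) // ge_max metric_sym !far.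
Qed.

Lemma preimage_cancel (S T : Type) (f : S -> T) (g : T -> S) :
  cancel f g -> cancel (preimage g) (preimage f).
Proof. by move=> fK B; apply/funext => x; rewrite /preimage /= fK. Qed.

(** The new parts are the preimages under [g] of the members of [P], that is, their images under
    [f]. *)
Lemma partition_preimage (S T : Type) (f : S -> T) (g : T -> S) (A : set S)
    (P : set (set S)) :
  cancel g f -> cancel f g -> partition P id A ->
  partition [set C | P (f @^-1` C)] id (g @^-1` A).
Proof.
move=> gK fK [<- trivP neP].
have gfK := preimage_cancel _ _ _ _ fK; have fgK := preimage_cancel _ _ _ _ gK.
split.
- apply/seteqP; split=> y /=.
    by move=> [C PC Cy]; exists (f @^-1` C) => //; rewrite /preimage /= gK.
  by move=> [B PB By]; exists (g @^-1` B) => //=; rewrite gfK.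
- move=> C D PC PD [y [Cy Dy]]; rewrite -(fgK C) -(fgK D); congr (g @^-1` _).
  by apply: (trivP _ _ PC PD); exists (g y); rewrite /preimage /= gK.
- by move=> C /neP[x Cfx]; exists (f x).
Qed.

Section ChildPreimage.
Context {R : realType} {X Y : metricType R} {f : X -> Y} {g : Y -> X}.
Hypotheses (ultX : ultrametric X) (ultY : ultrametric Y).
Hypotheses (finX : finite_set [set: X]) (finY : finite_set [set: Y]).
Hypotheses (gK : cancel g f) (fK : cancel f g).
Hypothesis f_le : forall x a b : X,
  (mdist (f x) (f a) <= mdist (f x) (f b)) = (mdist x a <= mdist x b).

(** By [diametricalP] both sides only compare distances from a common point, and [f_le] preserves
    such comparisons; the diameters themselves may change. *)
Lemma diametrical_preimage (A : set X) (u v : Y) :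
  diametrical (g @^-1` A) u v <-> diametrical A (g u) (g v).
Proof.
rewrite !diametricalP //; split=> -[Au Av far]; split=> // y Ay.
  by rewrite -f_le !gK far // /preimage /= fK.
by rewrite -[u]gK -[y]gK -[v]gK f_le far.
Qed.

Lemma multipartition_preimage (A : set X) (P : set (set X)) :
  multipartition A P -> multipartition (g @^-1` A) [set C | P (f @^-1` C)].
Proof.
have gfK := preimage_cancel _ _ _ _ fK; have fgK := preimage_cancel _ _ _ _ gK.
move=> [partP [B [C [PB PC BC]]] adjP]; split.
- exact: partition_preimage.
- exists (g @^-1` B), (g @^-1` C); rewrite /= !gfK; split => // BC'.
  by apply: BC; rewrite -(gfK B) BC' gfK.
- move=> u v Au Av; rewrite diametrical_preimage adjP //; split.
    move=> [D [E [PD PE DE Du Ev]]].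
    exists (g @^-1` D), (g @^-1` E); rewrite /= !gfK; split => // DE'.
    by apply: DE; rewrite -(gfK D) DE' gfK.
  move=> [D [E [PD PE DE Du Ev]]].
  exists (f @^-1` D), (f @^-1` E); rewrite /preimage /= !gK; split => // DE'.
  by apply: DE; rewrite -(fgK D) -(fgK E); congr (g @^-1` _).
Qed.

Lemma child_preimage (A B : set X) :
  child A B -> child (g @^-1` A) (g @^-1` B).
Proof.
move=> [[x [y [Ax Ay xy]]] [P [multP PB]]]; split.
  exists (f x), (f y); rewrite /preimage /= !fK; split => // fxy.
  by apply: xy; rewrite -(fK x) fxy fK.
exists [set C | P (f @^-1` C)]; split; first exact: multipartition_preimage.
by rewrite /= (preimage_cancel _ _ _ _ fK).
Qed.

Lemma tree_node_preimage (A : set X) : tree_node A -> tree_node (g @^-1` A).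
Proof.
elim=> [|{}A B _ IHA AB]; first by rewrite preimage_setT; exact: tree_node_root.
exact: tree_node_child _ _ IHA (child_preimage _ _ AB).
Qed.

End ChildPreimage.

Theorem theorem3p7 (R : realType) (X Y : metricType R)
  (finX : finite_set [set: X]) (neX : [set: X] !=set0) (ultX : ultrametric X)
  (finY : finite_set [set: Y]) (neY : [set: Y] !=set0) (ultY : ultrametric Y)
  (eta : R -> R) (eta_homeo : homeomorphism_half_line eta) (eta1 : eta 1 = 1)
  (f : X -> Y) (f_qs : quasisymmetric_embedding eta f)
  (f_surj : set_surj [set: X] [set: Y] f) :
  rooted_isomorphic (representing_tree X) (representing_tree Y).
Proof.
have f_inj : injective f by case: f_qs => -[].
have /choice[g gK] : forall y, exists x, f x = y.
  by move=> y; have [x _ <-] := f_surj y I; exists x.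
have fK : cancel f g by move=> x; apply: f_inj; rewrite gK.
have f_le x a b :
    (mdist (f x) (f a) <= mdist (f x) (f b)) = (mdist x a <= mdist x b).
  exact: (quasisymmetric_le _ _ _ _ _ _ _ _ eta_homeo eta1 f_qs).
(* The situation is now symmetric in [f] and [g], so children and nodes can be transported in both
   directions. *)
have g_le x a b :
    (mdist (g x) (g a) <= mdist (g x) (g b)) = (mdist x a <= mdist x b).
  by rewrite -f_le !gK.
have gfK := preimage_cancel _ _ _ _ fK; have fgK := preimage_cancel _ _ _ _ gK.
have childY := child_preimage ultX ultY finX finY gK fK f_le.
have childX := child_preimage ultY ultX finY finX fK gK g_le.
(* Each node goes to its image under [f]; the inverse map takes preimages under [f]. *)
exists (fun A => g @^-1` A); split => /=.
- split.
  + move=> A; exact: (tree_node_preimage ultX ultY finX finY gK fK f_le).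
  + by move=> A B _ _ AB; rewrite -(gfK A) AB gfK.
  + move=> C nodeC; exists (f @^-1` C) => //.
    exact: (tree_node_preimage ultY ultX finY finX fK gK g_le).
- exact: preimage_setT.
- move=> A B _ _; split=> -[AB|BA]; [left|right|left|right]; try exact: childY.
    (* Edges are reflected because children in [Y] pull back along [f] to children in [X]. *)
    by rewrite -(gfK A) -(gfK B); exact: childX.
  by rewrite -(gfK A) -(gfK B); exact: childX.
Qed.
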